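(* Let $(M,d)$ be a pointed separable metric space with base point $0$, let $f:M\to M$ be a Lipschitz map such that $f(0)=0$, and let $\lambda\in\mathbb{R}\setminus\{0\}$. Assume that there exist an increasing sequence of positive integers $(n_k)_{k\in\mathbb{N}}$, two dense subsets $\mathcal{D}_1,\mathcal{D}_2$ of $M$ and a sequence of maps $g_{n_k}:\mathcal{D}_2\to M$ such that, for any $x\in\mathcal{D}_1$ and $y\in\mathcal{D}_2$, the following conditions hold: (1) $|\lambda|^{n_k}\,d(f^{n_k}(x),0)\to 0$ as $k\to+\infty$; (2) $\dfrac{d(g_{n_k}(y),0)}{|\lambda|^{n_k}}\to 0$ as $k\to+\infty$; (3) $d(f^{n_k}\circ g_{n_k}(y),y)\to 0$ as $k\to+\infty$. Then the operator $\lambda\widehat{f}:\mathcal{F}(M)\to\mathcal{F}(M)$ satisfies the Hypercyclicity Criterion. In particular, $\lambda\widehat{f}$ is hypercyclic.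
   Context: For a metric space $(M,d)$ with base point $0$, $\mathrm{Lip}_0(M)$ is the real Banach space of Lipschitz functions $M\to\mathbb{R}$ vanishing at $0$, with norm the best Lipschitz constant. For $x\in M$, $\delta(x)\in \mathrm{Lip}_0(M)^*$ is the evaluation $\langle \varphi,\delta(x)\rangle=\varphi(x)$. The Lipschitz-free space is $\mathcal{F}(M)=\overline{\mathrm{span}}^{\|\cdot\|}\{\delta(x):x\in M\}\subset \mathrm{Lip}_0(M)^*$. If $f:M\to M$ is Lipschitz with $f(0)=0$, $\widehat{f}:\mathcal{F}(M)\to\mathcal{F}(M)$ is the unique bounded linear operator with $\widehat{f}(\delta(x))=\delta(f(x))$ for all $x\in M$. Hypercyclicity Criterion: a bounded linear operator $T:X\to X$ on a separable Banach space $X$ satisfies it if there exist an increasing sequence of positive integers $(m_k)$, two dense sets $X_0,Y_0\subset X$ and a sequence of maps $S_{m_k}:Y_0\to X$ such that $T^{m_k}x\to0$ for every $x\in X_0$; $S_{m_k}y\to 0$ for every $y\in Y_0$; and $T^{m_k}S_{m_k}y\to y$ for every $y\in Y_0$. $T$ is hypercyclic if there is $x\in X$ whose orbit $\{T^nx:n\ge0\}$ is dense in $X$. *)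

(* Defs.v *)
From HB Require Import structures.
From mathcomp Require Import all_boot all_order all_algebra.
From mathcomp Require Import all_classical all_reals all_analysis.

Set Implicit Arguments.
Unset Strict Implicit.
Unset Printing Implicit Defensive.

Import Order.TTheory GRing.Theory Num.Theory.
Import numFieldNormedType.Exports.

Local Open Scope classical_set_scope.
Local Open Scope ring_scope.

Definition separable (T : topologicalType) : Prop :=
  exists D : set T, countable D /\ dense D.

Definition bounded_linear (R : realType) (V W : normedModType R)
    (T : V -> W) : Prop :=
  linear T /\ exists C : R, forall x, `|T x| <= C * `|x|.

Section hypercyclicity.
Context (R : realType) (X : completeNormedModType R) (T : X -> X).

(* Only the values of [S (m k)] on [Y0] matter, so the maps [Y0 -> X] are
   taken to be total functions. *)
Definition hypercyclicity_criterion : Prop :=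
  [/\ separable X, bounded_linear T &
    exists (m : nat -> nat) (X0 Y0 : set X) (S : nat -> X -> X),
      [/\ (forall k, (0 < m k)%N) /\ {homo m : i j / (i < j)%N},
          dense X0 /\ dense Y0,
          forall x, X0 x -> iter (m k) T x @[k --> \oo] --> (0 : X),
          forall y, Y0 y -> S (m k) y @[k --> \oo] --> (0 : X) &
          forall y, Y0 y -> iter (m k) T (S (m k) y) @[k --> \oo] --> y]].

Definition hypercyclic : Prop := exists x : X, dense (range (fun n => iter n T x)).

End hypercyclicity.

(* The best constant [K] in the inequalities [a i <= K * b i]. *)
Definition best_constant (R : realType) (I : Type) (a b : I -> R) : R :=
  inf [set K | 0 <= K /\ forall i, a i <= K * b i].

Section best_constant_theory.
Context (R : realType) (I : Type).
Implicit Types (a b : I -> R) (K : R).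

Lemma best_constant_ge0 a b : 0 <= best_constant a b.
Proof.
rewrite /best_constant; have [->|/set0P ne] :=
  eqVneq [set K | 0 <= K /\ forall i, a i <= K * b i] set0; first by rewrite inf0.
by apply: lb_le_inf => // x [].
Qed.

Lemma best_constant_le a b K : 0 <= K -> (forall i, a i <= K * b i) ->
  best_constant a b <= K.
Proof. by move=> K0 Kab; apply: ge_inf; [exists 0 => x []|split]. Qed.

Lemma best_constantP a b : (forall i, 0 <= b i) ->
  (exists K, forall i, a i <= K * b i) ->
  forall i, a i <= best_constant a b * b i.
Proof.
move=> b0 [K Kab] i.
have ne : [set K | 0 <= K /\ forall i, a i <= K * b i] !=set0.
  exists `|K|; split=> // j; rewrite (le_trans (Kab j))//.
  by rewrite ler_wpM2r// ler_norm.
have := b0 i; rewrite le_eqVlt => /predU1P[bi0|bi0].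
  by rewrite -bi0 mulr0; have := Kab i; rewrite -bi0 mulr0.
rewrite -ler_pdivrMr//; apply: lb_le_inf => // x [_ /(_ i)].
by rewrite ler_pdivrMr.
Qed.

End best_constant_theory.

Section lip0.
Context (R : realType) (M : metricType R) (o : M).
Implicit Types phi : M -> R^o.

Definition lip0_pred : {pred M -> R^o} := fun phi =>
  `[< phi o = 0 /\
      exists K, forall x y, `|phi x - phi y| <= K * mdist x y >].

Record lip0 := Lip0 { lip0_val :> M -> R^o; _ : lip0_val \in lip0_pred }.

HB.instance Definition _ := [isSub for lip0_val].
HB.instance Definition _ := [Choice of lip0 by <:].

Lemma lip0_submod_closed : submod_closed lip0_pred.
Proof.
split.
  rewrite inE; split=> //; exists 0 => x y.
  by rewrite mul0r subrr normr0.
move=> a phi psi; rewrite !inE => -[phi0 [K HK]] [psi0 [L HL]].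
split.
  rewrite /GRing.add/= /GRing.scale/= phi0 psi0.
  by rewrite [LHS]addr0 [LHS]mulr0.
exists (`|a| * K + L) => x y.
rewrite [X in `|X|](_ : _ = a * (phi x - phi y) + (psi x - psi y)); last first.
  by rewrite mulrBr opprD addrACA.
rewrite (le_trans (ler_normD _ _))// mulrDl lerD// normrM -mulrA.
by rewrite ler_wpM2l.
Qed.

HB.instance Definition _ :=
  GRing.isSubmodClosed.Build R (M -> R^o) lip0_pred lip0_submod_closed.
HB.instance Definition _ := [SubChoice_isSubLmodule of lip0 by <:].

Definition lip0_norm (phi : lip0) : R :=
  best_constant (fun p : M * M => `|phi p.1 - phi p.2|)
                (fun p => mdist p.1 p.2).

Lemma lip0_base (phi : lip0) : phi o = 0.
Proof. by case: phi => f /=; rewrite inE => -[]. Qed.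

Lemma lip0_normP (phi : lip0) x y :
  `|phi x - phi y| <= lip0_norm phi * mdist x y.
Proof.
apply: (@best_constantP _ _ (fun p : M * M => `|phi p.1 - phi p.2|)
  (fun p => mdist p.1 p.2) _ _ (x, y)) => [p|]; first exact: mdist_ge0.
by case: phi => f /=; rewrite inE => -[_ [K HK]]; exists K => -[].
Qed.

Lemma lip0_norm_le (phi : lip0) K : 0 <= K ->
  (forall x y, `|phi x - phi y| <= K * mdist x y) -> lip0_norm phi <= K.
Proof. by move=> K0 HK; apply: best_constant_le => // -[x y] /=; exact: HK. Qed.

Let lip0_normD (phi psi : lip0) :
  lip0_norm (phi + psi) <= lip0_norm phi + lip0_norm psi.
Proof.
apply: lip0_norm_le => [|x y]; first by rewrite addr_ge0// best_constant_ge0.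
rewrite [X in `|X|](_ : _ = (phi x - phi y) + (psi x - psi y)); last first.
  by rewrite addrACA -opprD.
by rewrite (le_trans (ler_normD _ _))// mulrDl lerD// lip0_normP.
Qed.

Let lip0_normZ_le (a : R) (phi : lip0) :
  lip0_norm (a *: phi) <= `|a| * lip0_norm phi.
Proof.
apply: lip0_norm_le => [|x y]; first by rewrite mulr_ge0// best_constant_ge0.
rewrite [X in `|X|](_ : _ = a * (phi x - phi y)); last by rewrite mulrBr.
by rewrite normrM -mulrA ler_wpM2l// lip0_normP.
Qed.

Let lip0_normZ (a : R) (phi : lip0) :
  lip0_norm (a *: phi) = `|a| * lip0_norm phi.
Proof.
apply/eqP; rewrite eq_le lip0_normZ_le/=.
have [->|a0] := eqVneq a 0; first by rewrite normr0 mul0r best_constant_ge0.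
rewrite -ler_pdivlMl ?normr_gt0// -normfV.
by rewrite -[X in lip0_norm X <= _](scalerK a0) lip0_normZ_le.
Qed.

Let lip0_norm0_eq0 (phi : lip0) : lip0_norm phi = 0 -> phi = 0.
Proof.
move=> phi0; apply: val_inj; apply/funext => x /=.
have := lip0_normP phi x o.
by rewrite phi0 mul0r lip0_base subr0 normr_le0 => /eqP.
Qed.

HB.instance Definition _ :=
  Lmodule_isNormed.Build R lip0 lip0_normD lip0_normZ lip0_norm0_eq0.

Lemma lip0_normE (phi : lip0) : `|phi| = lip0_norm phi. Proof. by []. Qed.

Lemma lip0_le (phi : lip0) x y : `|phi x - phi y| <= `|phi| * mdist x y.
Proof. exact: lip0_normP. Qed.

End lip0.

Section dual.
Context (R : realType) (V : normedModType R).

Definition dual_pred : {pred V -> R^o} := fun u => `[< bounded_linear u >].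

Record dual := Dual { dual_val :> V -> R^o; _ : dual_val \in dual_pred }.

HB.instance Definition _ := [isSub for dual_val].
HB.instance Definition _ := [Choice of dual by <:].

Lemma dual_submod_closed : submod_closed dual_pred.
Proof.
split.
  rewrite inE; split=> [a v w|]; first by rewrite [RHS]addr0 scaler0.
  by exists 0 => v; rewrite mul0r normr0.
move=> a u1 u2; rewrite !inE => -[lin1 [K HK]] [lin2 [L HL]]; split.
  move=> b v w; rewrite /GRing.add/= /GRing.scale/= lin1 lin2.
  rewrite /GRing.scale/= !mulrDr addrACA; congr (_ + _ + _).
  by rewrite !mulrA [a * b]mulrC.
exists (`|a| * K + L) => v.
rewrite (le_trans (ler_normD _ _))// mulrDl lerD// normrM -mulrA.
by rewrite ler_wpM2l.
Qed.

HB.instance Definition _ :=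
  GRing.isSubmodClosed.Build R (V -> R^o) dual_pred dual_submod_closed.
HB.instance Definition _ := [SubChoice_isSubLmodule of dual by <:].

Lemma dual_bounded_linear (u : dual) : bounded_linear u.
Proof. by case: u => f /=; rewrite inE. Qed.

HB.instance Definition _ (u : dual) :=
  GRing.isLinear.Build R V R^o *:%R (dual_val u) (dual_bounded_linear u).1.

Definition dual_norm (u : dual) : R :=
  best_constant (fun v => `|u v|) (fun v => `|v|).

Lemma dual_normP (u : dual) v : `|u v| <= dual_norm u * `|v|.
Proof.
by apply: (@best_constantP _ _ (fun v => `|u v|)) => //; have [_ [K HK]] := dual_bounded_linear u; exists K.
Qed.

Lemma dual_norm_le (u : dual) K : 0 <= K ->
  (forall v, `|u v| <= K * `|v|) -> dual_norm u <= K.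
Proof. by move=> K0 HK; apply: best_constant_le. Qed.

Let dual_normD (u1 u2 : dual) :
  dual_norm (u1 + u2) <= dual_norm u1 + dual_norm u2.
Proof.
apply: dual_norm_le => [|v]; first by rewrite addr_ge0// best_constant_ge0.
by rewrite (le_trans (ler_normD _ _))// mulrDl lerD// dual_normP.
Qed.

Let dual_normZ_le (a : R) (u : dual) : dual_norm (a *: u) <= `|a| * dual_norm u.
Proof.
apply: dual_norm_le => [|v]; first by rewrite mulr_ge0// best_constant_ge0.
by rewrite normrM -mulrA ler_wpM2l// dual_normP.
Qed.

Let dual_normZ (a : R) (u : dual) : dual_norm (a *: u) = `|a| * dual_norm u.
Proof.
apply/eqP; rewrite eq_le dual_normZ_le/=.
have [->|a0] := eqVneq a 0; first by rewrite normr0 mul0r best_constant_ge0.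
rewrite -ler_pdivlMl ?normr_gt0// -normfV.
by rewrite -[X in dual_norm X <= _](scalerK a0) dual_normZ_le.
Qed.

Let dual_norm0_eq0 (u : dual) : dual_norm u = 0 -> u = 0.
Proof.
move=> u0; apply: val_inj; apply/funext => v /=.
by have := dual_normP u v; rewrite u0 mul0r normr_le0 => /eqP.
Qed.

HB.instance Definition _ :=
  Lmodule_isNormed.Build R dual dual_normD dual_normZ dual_norm0_eq0.

Lemma dual_normE (u : dual) : `|u| = dual_norm u. Proof. by []. Qed.

Lemma dual_le (u : dual) v : `|u v| <= `|u| * `|v|.
Proof. exact: dual_normP. Qed.

Let dual_complete (F : set_system dual) : ProperFilter F -> cauchy F -> cvg F.
Proof.
move=> FF /cauchyP Fex.
have Fc e : 0 < e ->
    exists2 A, F A & forall u1 u2, A u1 -> A u2 -> `|u1 - u2| <= e.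
  move=> e0; have [w Fw] := Fex _ (divr_gt0 e0 (ltr0Sn _ 1)).
  exists (ball w (e / 2)) => // u1 u2; rewrite -!ball_normE /ball_/= => w1 w2.
  by rewrite (le_trans (ler_distD w _ _))// (splitr e) lerD// ltW// distrC.
have cvgF v : cvg ((fun u : dual => u v : R^o) @ F).
  apply/cauchy_cvgP; apply: cauchy_exP => e e0.
  have v1 : 0 < `|v| + 1 by rewrite ltr_wpDl.
  have [w Fw] := Fex (e / (`|v| + 1)) (divr_gt0 e0 v1).
  exists (w v).
  suff : F [set u : dual | ball (w v : R^o) e (u v)] by [].
  apply: filterS Fw => u /=.
  rewrite -!ball_normE /ball_/= ltr_pdivlMr// => wu.
  rewrite -[w v - u v]/((w - u) v) (le_lt_trans (dual_le _ _))//.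
  by rewrite (le_lt_trans _ wu)// ler_wpM2l// lerDl.
pose l v : R^o := lim ((fun u : dual => u v : R^o) @ F).
have cvgl v : (fun u : dual => u v : R^o) @ F --> l v by exact: cvgF.
have ul e : 0 < e ->
    exists2 A, F A & forall u, A u -> forall v, `|u v - l v| <= e * `|v|.
  move=> e0; have [A FA HA] := Fc e e0; exists A => // u Au v.
  apply/ler_addgt0Pr => d d0.
  have /(@cvgrPdist_lt _ R^o) /(_ d d0) nl := cvgl v.
  have [u' [Au' lu']] := filter_ex (filterI FA nl).
  rewrite (le_trans (ler_distD (u' v) _ _))// lerD//; last first.
    by rewrite distrC ltW.
  rewrite -[u v - u' v]/((u - u') v) (le_trans (dual_le _ _))//.
  by rewrite ler_wpM2r// HA.
have l_lin : linear l.
  move=> a v w; apply: (@cvg_unique R^o (@norm_hausdorff _ R^o) _ _ _ _ (cvgl _)).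
  rewrite (_ : (fun u : dual => _) =
      (fun u : dual => (a *: (u v : R^o) + u w : R^o))).
    by apply: (@cvgD _ R^o) => //; apply: (@cvgZr _ R^o).
  by apply/funext => u; rewrite linearP.
have l_bnd : bounded_linear l.
  split=> //; have [A FA HA] := ul 1 ltr01.
  have [u Au] := filter_ex FA; exists (1 + `|u|) => v.
  rewrite mulrDl -[l v](subrK (u v)) (le_trans (ler_normD _ _))//.
  by rewrite lerD// ?dual_le// distrC HA.
have l_in : l \in dual_pred by rewrite inE.
apply/cvg_ex; exists (Dual l_in).
apply/cvgrPdist_le => e e0; have [A FA HA] := ul e e0.
apply: filterS FA => u Au; apply: dual_norm_le; first exact: ltW.
by move=> v; rewrite -[(_ - u) v]/(l v - u v) distrC HA.
Qed.

HB.instance Definition _ := Uniform_isComplete.Build dual dual_complete.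

End dual.

Section lipschitz_free.
Context (R : realType) (M : metricType R) (o : M).

Definition evaluation (x : M) : lip0 o -> R^o := fun phi => phi x.

Lemma evaluation_dual x : evaluation x \in @dual_pred R (lip0 o).
Proof.
rewrite inE; split=> [//|]; exists (mdist x o) => phi.
by have := lip0_le phi x o; rewrite lip0_base subr0 mulrC.
Qed.

Definition dual_delta (x : M) : dual (lip0 o) := Dual (evaluation_dual x).

Definition span_delta : set (dual (lip0 o)) :=
  [set u | exists s : seq (R * M), u = \sum_(p <- s) p.1 *: dual_delta p.2].

Definition lipfree_pred : {pred dual (lip0 o)} :=
  fun u => `[< closure span_delta u >].

Record lipfree :=
  LipFree { lipfree_val :> dual (lip0 o); _ : lipfree_val \in lipfree_pred }.

HB.instance Definition _ := [isSub for lipfree_val].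
HB.instance Definition _ := [Choice of lipfree by <:].

Lemma lipfree_predP u : reflect
  (forall e : R, 0 < e -> exists2 s, span_delta s & `|u - s| < e)
  (u \in lipfree_pred).
Proof.
apply: (iffP idP); rewrite inE.
  move=> clu e e0; have [s [ss]] := clu _ (nbhsx_ballx u e e0).
  by rewrite -ball_normE; exists s.
move=> H B /nbhs_ballP[e /= e0 eB]; have [s ss us] := H e e0.
by exists s; split=> //; apply: eB; rewrite -ball_normE.
Qed.

Lemma span_deltaP a u v :
  span_delta u -> span_delta v -> span_delta (a *: u + v).
Proof.
move=> [s ->] [t ->]; exists ([seq (a * p.1, p.2) | p <- s] ++ t).
rewrite big_cat big_map scaler_sumr; congr (_ + _).
by apply: eq_bigr => p _; rewrite scalerA.
Qed.

Lemma span_delta_lipfree u : span_delta u -> u \in lipfree_pred.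
Proof. by move=> su; apply/lipfree_predP => e e0; exists u; rewrite ?subrr ?normr0. Qed.

Lemma lipfree_submod_closed : submod_closed lipfree_pred.
Proof.
split; first by apply: span_delta_lipfree; exists [::]; rewrite big_nil.
move=> a u v /lipfree_predP Hu /lipfree_predP Hv.
apply/lipfree_predP => e e0.
have e20 : 0 < e / 2 by rewrite divr_gt0.
have a0 : 0 < `|a| + 1 by rewrite ltr_wpDl.
have [s ss us] := Hu _ (divr_gt0 e20 a0).
have [t st vt] := Hv _ e20.
exists (a *: s + t); first exact: span_deltaP.
rewrite opprD addrACA -scalerBr (splitr e).
rewrite (le_lt_trans (ler_normD _ _))// ler_ltD// normrZ.
move: us; rewrite ltr_pdivlMr// => /ltW; apply: le_trans.
by rewrite mulrC ler_wpM2l// lerDl.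
Qed.

HB.instance Definition _ := GRing.isSubmodClosed.Build R (dual (lip0 o))
  lipfree_pred lipfree_submod_closed.
HB.instance Definition _ := [SubChoice_isSubLmodule of lipfree by <:].

Definition lipfree_norm (u : lipfree) : R := `|lipfree_val u|.

Let lipfree_normD (u v : lipfree) :
  lipfree_norm (u + v) <= lipfree_norm u + lipfree_norm v.
Proof. exact: (ler_normD (lipfree_val u)). Qed.

Let lipfree_normZ (a : R) (u : lipfree) :
  lipfree_norm (a *: u) = `|a| * lipfree_norm u.
Proof. exact: (normrZ a (lipfree_val u)). Qed.

Let lipfree_norm0_eq0 (u : lipfree) : lipfree_norm u = 0 -> u = 0.
Proof. by move=> /normr0_eq0 u0; apply: val_inj. Qed.

HB.instance Definition _ :=
  Lmodule_isNormed.Build R lipfree lipfree_normD lipfree_normZ lipfree_norm0_eq0.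

Lemma lipfree_normE (u : lipfree) : `|u| = `|lipfree_val u|. Proof. by []. Qed.

Let lipfree_complete (F : set_system lipfree) :
  ProperFilter F -> cauchy F -> cvg F.
Proof.
move=> FF /cauchyP Fex.
have : cvg (lipfree_val @ F).
  apply/cauchy_cvgP; apply: cauchy_exP => e e0.
  have [w Fw] := Fex e e0; exists (lipfree_val w).
  suff : F [set u : lipfree | ball (lipfree_val w) e (lipfree_val u)] by [].
  by apply: filterS Fw => u /=; rewrite -!ball_normE.
move=> /cvg_ex[l /cvgrPdist_lt Fl].
have l_in : l \in lipfree_pred.
  apply/lipfree_predP => e e0; have e20 : 0 < e / 2 by rewrite divr_gt0.
  have [u lu] := filter_ex (Fl _ e20).
  have /lipfree_predP/(_ _ e20)[s ss us] : lipfree_val u \in lipfree_pred.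
    by case: u {lu}.
  exists s => //; rewrite (le_lt_trans (ler_distD (lipfree_val u) _ _))//.
  by rewrite (splitr e) ltrD.
apply/cvg_ex; exists (LipFree l_in); apply/cvgrPdist_lt => e e0.
by have := Fl e e0; apply: filterS.
Qed.

HB.instance Definition _ := Uniform_isComplete.Build lipfree lipfree_complete.

Lemma delta_subproof x : dual_delta x \in lipfree_pred.
Proof.
apply: span_delta_lipfree; exists [:: (1, x)].
by rewrite big_seq1 scale1r.
Qed.

Definition delta (x : M) : lipfree := LipFree (delta_subproof x).

Lemma lipfree_approx (u : lipfree) (e : R) : 0 < e ->
  exists s : seq (R * M), `|u - \sum_(p <- s) p.1 *: delta p.2| < e.
Proof.
move=> e0; have : lipfree_val u \in lipfree_pred by case: u.
move=> /lipfree_predP/(_ e e0)[_ [s ->] us]; exists s; move: us.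
suff -> : `|u - \sum_(p <- s) p.1 *: delta p.2| =
    `|lipfree_val u - \sum_(p <- s) p.1 *: dual_delta p.2| by [].
rewrite lipfree_normE -[lipfree_val (_ - _)]/(val _) raddfB raddf_sum.
by congr (`|_ - _|); apply: eq_bigr => p _; rewrite linearZ.
Qed.

Lemma bounded_linear_delta_ext (W : normedModType R) (T1 T2 : lipfree -> W) :
  bounded_linear T1 -> bounded_linear T2 ->
  (forall x, T1 (delta x) = T2 (delta x)) -> T1 = T2.
Proof.
move=> [lin1 [K HK]] [lin2 [L HL]] T12.
pose L1 := GRing.isLinear.Build R lipfree W *:%R T1 lin1.
pose L2 := GRing.isLinear.Build R lipfree W *:%R T2 lin2.
pose S1 : {linear lipfree -> W} := HB.pack T1 L1.
pose S2 : {linear lipfree -> W} := HB.pack T2 L2.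
have S12 s : S1 (\sum_(p <- s) p.1 *: delta p.2) =
             S2 (\sum_(p <- s) p.1 *: delta p.2).
  by rewrite !linear_sum; apply: eq_bigr => p _; rewrite !linearZ/= T12.
apply/funext => u; apply/eqP; rewrite -subr_eq0 -normr_le0.
apply/ler_addgt0Pr => e e0; rewrite add0r.
have KL0 : 0 < `|K| + `|L| + 1 by rewrite ltr_wpDl// addr_ge0.
have [s us] := lipfree_approx u (divr_gt0 e0 KL0).
set v := \sum_(p <- s) _ in us.
have -> : T1 u - T2 u = T1 (u - v) - T2 (u - v).
  have /= -> := linearB S1 u v; have /= -> := linearB S2 u v.
  by rewrite (S12 s : T1 v = T2 v) opprB addrA subrK.
rewrite (le_trans (ler_normB _ _))// (le_trans (lerD (HK _) (HL _)))//.
rewrite -mulrDl; move: us; rewrite ltr_pdivlMr// mulrC => /ltW; apply: le_trans.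
by rewrite ler_wpM2r// -[leLHS]addr0 lerD// lerD// ler_norm.
Qed.

End lipschitz_free.

Definition lipschitz_map (R : realType) (M N : metricType R) (f : M -> N) :=
  exists K : R, forall x y, mdist (f x) (f y) <= K * mdist x y.

Section linearization.
Context (R : realType) (M : metricType R) (o : M) (f : M -> M).
Hypotheses (lipf : lipschitz_map f) (fo : f o = o).

Let lip_const : exists2 K : R, 0 <= K &
  forall x y, mdist (f x) (f y) <= K * mdist x y.
Proof.
have [K HK] := lipf; exists `|K| => // x y; rewrite (le_trans (HK x y))//.
by rewrite ler_wpM2r ?mdist_ge0// ler_norm.
Qed.

Let comp_lip0 (phi : lip0 o) : ((phi \o f) : M -> R^o) \in lip0_pred o.
Proof.
rewrite inE; split; first by rewrite /= fo lip0_base.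
have [K K0 HK] := lip_const; exists (`|phi| * K) => x y.
by rewrite (le_trans (lip0_le phi _ _))// -mulrA ler_wpM2l//.
Qed.

Let C (phi : lip0 o) : lip0 o := Lip0 (comp_lip0 phi).

Let C_le K : 0 <= K -> (forall x y, mdist (f x) (f y) <= K * mdist x y) ->
  forall phi, `|C phi| <= K * `|phi|.
Proof.
move=> K0 HK phi; apply: lip0_norm_le; first by rewrite mulr_ge0.
move=> x y; rewrite (le_trans (lip0_le phi _ _))// [K * _]mulrC -mulrA.
by rewrite ler_wpM2l.
Qed.

Let adj_dual (u : dual (lip0 o)) :
  (fun phi => u (C phi)) \in @dual_pred R (lip0 o).
Proof.
rewrite inE; split.
  move=> a phi psi; rewrite (_ : C _ = a *: C phi + C psi) ?linearP//.
  exact: val_inj.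
have [K K0 HK] := lip_const; exists (`|u| * K) => phi.
by rewrite (le_trans (dual_le u _))// -mulrA ler_wpM2l// C_le.
Qed.

Let adj (u : dual (lip0 o)) : dual (lip0 o) := Dual (adj_dual u).

Let adj_linear : linear adj. Proof. by move=> a u v; apply: val_inj. Qed.

#[local] HB.instance Definition _ :=
  GRing.isLinear.Build R (dual (lip0 o)) (dual (lip0 o)) *:%R adj adj_linear.

Let adj_delta x : adj (dual_delta o x) = dual_delta o (f x).
Proof. exact: val_inj. Qed.

Let adj_le K : 0 <= K -> (forall x y, mdist (f x) (f y) <= K * mdist x y) ->
  forall u, `|adj u| <= K * `|u|.
Proof.
move=> K0 HK u; apply: dual_norm_le; first by rewrite mulr_ge0.
move=> phi; rewrite (le_trans (dual_le u _))// [K * _]mulrC -mulrA.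
by rewrite ler_wpM2l// C_le.
Qed.

Let adj_lipfree (u : lipfree o) : adj u \in @lipfree_pred R M o.
Proof.
have [K K0 HK] := lip_const.
apply/lipfree_predP => e e0.
have K10 : 0 < K + 1 by rewrite ltr_wpDl.
have /lipfree_predP/(_ _ (divr_gt0 e0 K10)) : lipfree_val u \in @lipfree_pred R M o.
  by case: u.
move=> [_ [s ->] us]; exists (adj (\sum_(p <- s) p.1 *: dual_delta o p.2)).
  exists [seq (p.1, f p.2) | p <- s]; rewrite big_map linear_sum.
  by apply: eq_bigr => p _; rewrite linearZ/= adj_delta.
rewrite -linearB; apply: le_lt_trans (adj_le K0 HK _) _.
move: us; rewrite ltr_pdivlMr// mulrC; apply: le_lt_trans.
by rewrite ler_wpM2r// lerDl.
Qed.

Theorem linearization_exists_unique : exists! T : lipfree o -> lipfree o,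
  bounded_linear T /\ forall x, T (delta o x) = delta o (f x).
Proof.
have [K K0 HK] := lip_const.
exists (fun u => LipFree (adj_lipfree u)); split.
  split; last by move=> x; apply: val_inj; exact: adj_delta.
  split; first by move=> a u v; apply: val_inj; exact: adj_linear.
  by exists K => u; exact: adj_le.
move=> T [Tbl Td]; apply: bounded_linear_delta_ext => //.
- split; first by move=> a u v; apply: val_inj; exact: adj_linear.
  by exists K => u; exact: adj_le.
- by move=> x; rewrite Td; apply: val_inj; exact: adj_delta.
Qed.

(* The operator written [f] with a hat in the literature. *)
Definition linearization : lipfree o -> lipfree o :=
  sval (cid linearization_exists_unique).

Lemma linearization_bounded_linear : bounded_linear linearization.
Proof. by rewrite /linearization; case: cid => T [[]]. Qed.

Lemma linearization_delta x : linearization (delta o x) = delta o (f x).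
Proof. by rewrite /linearization; case: cid => T [[]]. Qed.

End linearization.

(* Main.v *)
(* Since [`|delta x - delta y| <= d(x, y)], combinations of the [delta x] with
   [x] in a dense subset of [M] are dense in the free space. For [X0] and [Y0]
   take the combinations supported on [D1] and [D2]: the three limits of the
   criterion then follow termwise from conditions (1)-(3). *)
Require Import Defs.
From HB Require Import structures.
From mathcomp Require Import all_boot all_order all_algebra.
From mathcomp Require Import all_classical all_reals all_analysis.

Import Order.TTheory GRing.Theory Num.Theory.
Import numFieldNormedType.Exports.

Local Open Scope classical_set_scope.
Local Open Scope ring_scope.

(** * Density through balls and through sequences *)

Lemma dense_ballP {R : numFieldType} {V : pseudoMetricType R} (A : set V) :
  dense A <-> forall x e, 0 < e -> exists2 y, A y & ball x e y.
Proof.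
split=> [dA x e e0|H O [x Ox] oO].
  have [|y [/interior_subset xy Ay]] := dA (ball x e)° _ (open_interior _).
    by exists x; exact: (nbhsx_ballx x e e0).
  by exists y.
have /nbhs_ballP[e /= e0 eO] := open_nbhs_nbhs (conj oO Ox).
by have [y Ay xy] := H x e e0; exists y; split=> //; exact: eO.
Qed.

(** The point [x] forces the countable dense set to be nonempty, so [nat] surjects onto it. *)
Lemma separable_seq (T : topologicalType) (x : T) : separable T ->
  exists e : nat -> T, dense (range e).
Proof.
move=> [D [cD dD]].
have [|y [_ Dy]] := dD [set: T] _ openT; first by exists x.
have /pfcard_geP[D0|[e]] := cD; first by move: Dy; rewrite D0.
by exists e; rewrite image_eq.
Qed.

(** * Bounded linear maps and limits in normed spaces *)

Section normed.
Context {R : realType} {V W : normedModType R}.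

Lemma linear_lincomb (I : Type) (T : V -> W) (s : seq I) (a : I -> R)
    (v : I -> V) : linear T ->
  T (\sum_(i <- s) a i *: v i) = \sum_(i <- s) a i *: T (v i).
Proof.
move=> linT; pose S : {linear V -> W} :=
  HB.pack T (GRing.isLinear.Build R V W *:%R T linT).
rewrite -[T _]/(S _) linear_sum.
by apply: eq_bigr => i _; rewrite linearZ.
Qed.

Lemma linear_sub (T : V -> W) (u v : V) : linear T -> T (u - v) = T u - T v.
Proof.
by move=> linT; rewrite addrC -scaleN1r linT scaleN1r addrC.
Qed.

Lemma continuous_of_bounded_linear (T : V -> W) : bounded_linear T -> continuous T.
Proof.
move=> [linT [C TC]] x; apply/cvgrPdist_lt => e e0.
(* The bound [C] may be zero or negative; [|C| + 1] can be divided by. *)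
have C0 : 0 < `|C| + 1 by rewrite ltr_wpDl.
near=> y.
rewrite -linear_sub// (le_lt_trans (TC _))//.
apply: (@le_lt_trans _ _ ((`|C| + 1) * `|x - y|)).
  by rewrite ler_wpM2r// (le_trans (ler_norm C))// lerDl.
rewrite mulrC -ltr_pdivlMr//; near: y.
by apply: cvgr_dist_lt; rewrite ?divr_gt0.
Unshelve. all: by end_near. Qed.

(** Used for one term of a combination: [C] is the absolute value of its coefficient and [r] one of
    the three sequences assumed to tend to zero. *)
Lemma cvg_dist_le (v : nat -> V) (l : V) (r : nat -> R) (C : R) :
  (forall k, `|v k - l| <= C * r k) -> r k @[k --> \oo] --> (0 : R) ->
  v k @[k --> \oo] --> l.
Proof.
move=> vr r0; apply/subr_cvg0; apply: norm_cvg0.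
apply: (@squeeze_cvgr _ _ _ _ (fun=> 0) (fun k => C * r k)).
- by near=> k; rewrite normr_ge0 vr.
- exact: cvg_cst.
- by rewrite -(mulr0 C); apply: cvgMl_tmp.
Unshelve. all: by end_near. Qed.

(** Convergence is asked only for members of [s], since the limits are known only at points of [D1]
    or [D2]. *)
Lemma cvg_sum_in (I : eqType) (s : seq I) (v : I -> nat -> V) (l : I -> V) :
  (forall i, i \in s -> v i k @[k --> \oo] --> l i) ->
  \sum_(i <- s) v i k @[k --> \oo] --> \sum_(i <- s) l i.
Proof.
move=> vl; rewrite big_seq; under eq_fun do rewrite big_seq.
by apply: cvg_big => //; exact: add_continuous.
Qed.

Lemma cvg_sum0_in (I : eqType) (s : seq I) (v : I -> nat -> V) :
  (forall i, i \in s -> v i k @[k --> \oo] --> (0 : V)) ->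
  \sum_(i <- s) v i k @[k --> \oo] --> (0 : V).
Proof. by move=> /cvg_sum_in; rewrite big1_eq. Qed.

End normed.

(** * From the criterion to a dense orbit *)

(* Birkhoff's transitivity argument: the vectors whose orbit meets a given ball
   form a dense open set, so by Baire some orbit meets every ball of a countable
   basis. *)
Lemma hypercyclicity_criterion_hypercyclic (R : realType)
    (X : completeNormedModType R) (T : X -> X) :
  hypercyclicity_criterion T -> hypercyclic T.
Proof.
move=> [sepX blT [m [X0 [Y0 [S [_ [dX0 dY0] TX0 SY0 TSY0]]]]]].
have contT n : continuous (iter n T).
  elim: n => [|n IH] x; first exact: cvg_id.
  by apply: (@continuous_comp _ _ _ (iter n T) T); [exact: IH|exact: continuous_of_bounded_linear].
have linT n : linear (iter n T).
  by elim: n => // n IH a u v; rewrite /= IH blT.1.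
have [e de] := separable_seq X 0 sepX.
pose B (p : nat * nat) : set X := ball (e p.1) p.2.+1%:R^-1.
pose U p : set X := \bigcup_n (iter n T @^-1` B p).
have oU p : open (U p).
  apply: bigcup_open => n _; apply: open_comp; last exact: ball_open.
  by move=> x _; exact: contT.
have dU p : dense (U p).
  move=> O [w Ow] oO.
  have [|x [Ox X0x]] := dX0 O _ oO; first by exists w.
  have [y Y0y By] := (dense_ballP Y0).1 dY0 (e p.1) p.2.+1%:R^-1 ltac:(by []).
  (* Adding [S (m k) y] perturbs [x] by a vanishing amount, while the iterate of the sum tends to
     [y] because that of [x] dies out. For large [k] the sum thus lies in [O] and its orbit enters
     [B p]. *)
  have cvgx : x + S (m k) y @[k --> \oo] --> x.
    by rewrite -[X in _ --> X]addr0; apply: cvgD; [exact: cvg_cst|exact: SY0].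
  have cvgy : iter (m k) T (x + S (m k) y) @[k --> \oo] --> y.
    rewrite -[X in _ --> X]add0r (_ : (fun k => _) =
        fun k => iter (m k) T x + iter (m k) T (S (m k) y)).
      by apply: cvgD; [exact: TX0|exact: TSY0].
    by apply/funext => k; have := linT (m k) 1 x (S (m k) y); rewrite !scale1r.
  have nO : \forall k \near \oo, O (x + S (m k) y).
    by apply: cvgx; apply: open_nbhs_nbhs.
  have nB : \forall k \near \oo, B p (iter (m k) T (x + S (m k) y)).
    by apply: cvgy; apply: open_nbhs_nbhs; split=> //; exact: ball_open.
  have [k [Ok Bk]] := filter_ex (filterI nO nB).
  by exists (x + S (m k) y); split=> //; exists (m k).
(* Baire takes a family indexed by [nat], so pairs are decoded from their codes; a number coding no
   pair falls back on [(0, 0)], which only repeats a member. *)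
pose F i := U (odflt (0, 0)%N (unpickle i)).
have [|x [_ Fx]] := @Baire R X F (fun i => conj (oU _) (dU _)) setT _ openT.
  by exists 0.
exists x; apply/dense_ballP => u d d0.
have d20 : 0 < d / 2 by rewrite divr_gt0.
(* The distance [d] is split in two: from [u] to a centre [e j], and from [e j] to the orbit. *)
have [l _ ld] := near_infty_natSinv_lt (PosNum d20).
have {}ld : l.+1%:R^-1 <= d / 2 := ltW (ld l (leqnn l)).
have [_ [j _ <-] uj] := (dense_ballP _).1 de u l.+1%:R^-1 ltac:(by []).
have [n _ /= Bn] := Fx (pickle (j, l)) I; exists (iter n T x); first by exists n.
move: Bn; rewrite pickleK /= => Bn.
rewrite [d]splitr; apply: (ball_triangle (y := e j)); apply: (le_ball ld).
  exact: uj.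
exact: Bn.
Qed.

(** * Density of combinations of evaluations, and separability *)

Section lincomb.
Context {R : realType} {M : metricType R} (o : M).
Implicit Types s : seq (R * M).

Lemma delta_dist_le (x y : M) : `|delta o x - delta o y| <= mdist x y.
Proof.
apply: dual_norm_le => [|phi]; first exact: mdist_ge0.
by rewrite mulrC; exact: lip0_le.
Qed.

Lemma delta_base : delta o o = 0.
Proof. by do 2 apply: val_inj => /=; apply/funext => phi; exact: lip0_base. Qed.

Lemma delta_norm_le (x : M) : `|delta o x| <= mdist x o.
Proof. by rewrite -[delta o x]subr0 -delta_base delta_dist_le. Qed.

Definition lincomb s : lipfree o := \sum_(p <- s) p.1 *: delta o p.2.

(** The set [A] has two uses: all reals for [X0] and [Y0], the rationals for separability. *)
Definition seq_over (A : set R) (D : set M) : set (seq (R * M)) :=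
  [set s | forall p, p \in s -> A p.1 /\ D p.2].

Lemma lincomb_approx (A : set R) (D : set M) s (e : R) :
    dense A -> dense D -> 0 < e ->
  exists2 t, seq_over A D t & `|lincomb s - lincomb t| < e.
Proof.
move=> dA dD; elim: s e => [|[a x] s IH] e e0.
  by exists [::] => //; rewrite subrr normr0.
have e20 : 0 < e / 2 by rewrite divr_gt0.
have e40 : 0 < e / 2 / 2 by rewrite divr_gt0.
have [t At st] := IH _ e20.
have a0 : 0 < `|a| + 1 by rewrite ltr_wpDl.
(* The point [y] is chosen before the coefficient [b], whose tolerance depends on the norm of
   [delta o y]. Each gets a quarter of [e]; the tail of the list gets half. *)
have [y Dy] := (dense_ballP D).1 dD x _ (divr_gt0 e40 a0).
rewrite ballEmdist/= ltr_pdivlMr// => xy.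
have y0 : 0 < `|delta o y| + 1 by rewrite ltr_wpDl.
have [b Ab] := (dense_ballP A).1 dA a _ (divr_gt0 e40 y0).
rewrite -ball_normE/= ltr_pdivlMr// => ab.
exists ((b, y) :: t).
  by move=> p; rewrite inE => /predU1P[->|/At].
rewrite /lincomb !big_cons /= opprD addrACA (splitr e).
rewrite (le_lt_trans (ler_normD _ _))// ltrD//.
rewrite (_ : _ - _ = a *: (delta o x - delta o y) + (a - b) *: delta o y); last first.
  by rewrite scalerBr scalerBl addrA subrK.
rewrite (le_lt_trans (ler_normD _ _))// (splitr (e / 2)) ltrD// normrZ.
  apply: le_lt_trans xy; rewrite mulrC ler_pM// ?delta_dist_le//.
  by rewrite lerDl.
by apply: le_lt_trans ab; rewrite ler_wpM2l// lerDl.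
Qed.

Lemma dense_lincomb (A : set R) (D : set M) :
  dense A -> dense D -> dense (lincomb @` seq_over A D).
Proof.
move=> dA dD; apply/dense_ballP => u e e0.
have e20 : 0 < e / 2 by rewrite divr_gt0.
have [s us] := lipfree_approx u e20.
have [t At st] := lincomb_approx _ _ s _ dA dD e20.
exists (lincomb t); first by exists t.
rewrite -ball_normE/= (splitr e).
by rewrite (le_lt_trans (ler_distD (lincomb s) _ _))// ltrD.
Qed.

(** Rational combinations of a dense sequence of points are indexed by the countable type
    [seq (rat * nat)]. *)
Lemma lipfree_separable : separable M -> separable (lipfree o).
Proof.
move=> /(separable_seq M o)[e de].
pose h (s : seq (rat * nat)) := lincomb [seq (ratr p.1, e p.2) | p <- s].
exists (range h); split; first by apply: sub_countable (card_image_le _ _) _.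
move=> O O0 oO.
have [u [Ou [s As su]]] := dense_lincomb _ _ (@dense_rat R) de _ O0 oO.
rewrite -su in Ou; exists (lincomb s); split=> //.
suff [t ->] : exists t : seq (rat * nat), s = [seq (ratr p.1, e p.2) | p <- t].
  by exists t.
elim: s As {su Ou} => [_|[a x] s IH As]; first by exists [::].
have [[q _ /= qa] [j _ /= jx]] := As (a, x) (mem_head _ _).
have [|t ->] := IH; first by move=> p ps; apply: As; rewrite inE ps orbT.
by exists ((q, j) :: t); rewrite /= qa jx.
Qed.

End lincomb.

(** * Iterates of the scaled linearization on combinations *)

Section scaled_linearization.
Context {R : realType} {M : metricType R} {o : M} {f : M -> M}.
Context (lipf : lipschitz_map f) (fo : f o = o) (lambda : R).

Let T (u : lipfree o) : lipfree o := lambda *: linearization lipf fo u.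

Lemma scaled_linearization_bounded_linear : bounded_linear T.
Proof.
have [linf [C HC]] := linearization_bounded_linear lipf fo.
split=> [a u v|]; first by rewrite /T linf scalerDr !scalerA mulrC.
exists (`|lambda| * C) => u.
by rewrite normrZ -mulrA ler_wpM2l.
Qed.

Lemma iter_scaled_linearization k (s : seq (R * M)) :
  iter k T (lincomb o s) =
  \sum_(p <- s) (lambda ^+ k * p.1) *: delta o (iter k f p.2).
Proof.
elim: k => [|k IH] /=.
  by apply: eq_bigr => p _; rewrite expr0 mul1r.
rewrite IH linear_lincomb; last exact: scaled_linearization_bounded_linear.1.
apply: eq_bigr => p _; rewrite /T linearization_delta scalerA exprS.
by rewrite mulrC mulrA.
Qed.

End scaled_linearization.

(** * Verification of the criterion *)

Theorem theorem3p1 (R : realType) (M : metricType R) (o : M)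
    (sepM : separable M)
    (f : M -> M) (lipf : lipschitz_map f) (fo : f o = o)
    (lambda : R) (lambda_neq0 : lambda != 0)
    (n : nat -> nat) (n_gt0 : forall k, (0 < n k)%N)
    (n_incr : {homo n : i j / (i < j)%N})
    (D1 D2 : set M) (D1_dense : dense D1) (D2_dense : dense D2)
    (g : nat -> M -> M)
    (hfg : forall x y, D1 x -> D2 y ->
      [/\ `|lambda| ^+ n k * mdist (iter (n k) f x) o @[k --> \oo] --> (0 : R),
          mdist (g (n k) y) o / `|lambda| ^+ n k @[k --> \oo] --> (0 : R) &
          mdist (iter (n k) f (g (n k) y)) y @[k --> \oo] --> (0 : R)]) :
  let T : lipfree o -> lipfree o := fun u => lambda *: linearization lipf fo u in
  hypercyclicity_criterion T /\ hypercyclic T.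
Proof.
move=> T; suff crit : hypercyclicity_criterion T.
  by split=> //; exact: hypercyclicity_criterion_hypercyclic.
(* The limits in [hfg] are stated for a pair of points, so extracting one that concerns a single
   point requires a partner in the other dense set. *)
have [x1 D1x1] : D1 !=set0.
  by have [|x [_ ?]] := D1_dense setT _ openT; [exists o|exists x].
have [y1 D2y1] : D2 !=set0.
  by have [|x [_ ?]] := D2_dense setT _ openT; [exists o|exists x].
have dR : dense [set: R^o] by move=> O [x Ox] _; exists x.
split.
- exact: lipfree_separable.
- exact: scaled_linearization_bounded_linear.
(* The maps [S k] are only required to be functions, so it suffices to apply
   [delta y |-> lambda ^- k *: delta (g k y)] to a chosen representation. *)
pose reps v := [set s | seq_over setT D2 s /\ lincomb o s = v].
pose repr v := xget [::] (reps v).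
have reprP v : (lincomb o @` seq_over setT D2) v ->
    seq_over setT D2 (repr v) /\ lincomb o (repr v) = v.
  by move=> [s s2 sv]; apply: (@xgetPex _ [::] (reps v)); exists s.
pose Ss k s := [seq (p.1 / lambda ^+ k, g k p.2) | p <- s].
exists n, (lincomb o @` seq_over setT D1), (lincomb o @` seq_over setT D2),
  (fun k v => lincomb o (Ss k (repr v))).
split=> //.
- by split; exact: dense_lincomb.
- move=> _ [s sD <-].
  under eq_fun do rewrite iter_scaled_linearization.
  apply: cvg_sum0_in => -[a x] /sD[_ /= D1x].
  have [cx _ _] := hfg x y1 D1x D2y1.
  apply: (cvg_dist_le _ _ _ `|a|) cx => k /=; rewrite subr0 normrZ normrM normrX.
  by rewrite mulrCA mulrA ler_wpM2l// ?mulr_ge0// delta_norm_le.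
- move=> v /reprP[+ _]; set s := repr v => sD.
  rewrite /lincomb; under eq_fun do rewrite big_map.
  apply: cvg_sum0_in => -[a y] /sD[_ /= D2y].
  have [_ cy _] := hfg x1 y D1x1 D2y.
  apply: (cvg_dist_le _ _ _ `|a|) cy => k /=; rewrite subr0 normrZ normrM normfV normrX.
  by rewrite [_ / _ in leRHS]mulrC mulrA ler_wpM2l// ?mulr_ge0// delta_norm_le.
- move=> v /reprP[]; set s := repr v => sD <-.
  under eq_fun do rewrite iter_scaled_linearization big_map.
  apply: cvg_sum_in => -[a y] /sD[_ /= D2y].
  have [_ _ cy] := hfg x1 y D1x1 D2y.
  apply: (cvg_dist_le _ _ _ `|a|) cy => k /=.
  (* The powers of [lambda] cancel, leaving [a] times a difference of two evaluations, bounded by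
     the distance in condition (3). *)
  rewrite mulrCA divff ?expf_neq0// mulr1 -scalerBr normrZ.
  by rewrite ler_wpM2l// delta_dist_le.
Qed.
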